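(* Let $p$ be an odd prime, and let $a\in\mathbb{Z}_p$ with $a\not\equiv 0\pmod p$. Then $$\sum_{k=0}^{p-1}\Big(1-\frac{2}{a}k\Big)\binom ak^3\equiv (-1)^{\langle a\rangle_p}\frac{a-\langle a\rangle_p}{a}+\frac{(a-\langle a\rangle_p)^3}{a}E_{p-3}(-a)\pmod{p^4}$$ and $$\sum_{k=0}^{p-1}\Big(1-\frac{2}{a}k\Big)^3\binom ak^3\equiv -3(-1)^{\langle a\rangle_p}\frac{a-\langle a\rangle_p}{a}+\Big(\frac{a-\langle a\rangle_p}{a}\Big)^3\big(4-3a^2E_{p-3}(-a)\big)\pmod{p^4}.$$
   Context: $\mathbb{Z}_p$ denotes the set of rational numbers whose denominator is not divisible by $p$; congruences are taken in $\mathbb{Z}_p$. For $a\in\mathbb{Z}_p$, $\langle a\rangle_p$ is the unique integer in $\{0,1,\dots,p-1\}$ with $a\equiv\langle a\rangle_p\pmod p$. The general binomial coefficient is $\binom a0=1$, $\binom ak=a(a-1)\cdots(a-k+1)/k!$ for $k\ge1$. The Euler numbers are defined by $E_0=1$, $E_{2n-1}=0$, $E_{2n}=-\sum_{k=1}^{n}\binom{2n}{2k}E_{2n-2k}$ ($n\ge1$), and the Euler polynomials by $E_n(x)=2^{-n}\sum_{k=0}^{n}\binom nk(2x-1)^{n-k}E_k$.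
   Formalization: The first congruence is stated only for p ≠ 3, because as printed it fails at p = 3, a = 4 (the two sides are 33 and 6, which differ by 27, not a multiple of 81); the second congruence is kept for every odd prime. *)

(* Defs.v *)
From mathcomp Require Import all_boot all_order all_algebra.

Set Implicit Arguments.
Unset Strict Implicit.
Unset Printing Implicit Defensive.

Import Order.TTheory GRing.Theory Num.Theory.
Local Open Scope ring_scope.

Definition Zp_loc (p : nat) : pred rat := [pred x | ~~ (p %| `|denq x|)%N].

(* Congruence in Z_p: x - y lies in m Z_p (for m != 0). *)
Definition eqmod_loc (p m : nat) (x y : rat) : bool :=
  (x - y) / m%:R \in Zp_loc p.

(* <a>_p, found by searching {0, ..., p-1}; it is p when a is not in Z_p. *)
Definition residue (p : nat) (a : rat) : nat :=
  find (fun r => eqmod_loc p p a r%:R) (iota 0 p).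

Definition gbinom (a : rat) (k : nat) : rat :=
  (\prod_(i < k) (a - i%:R)) / k`!%:R.

(* [:: E_(2n); ...; E_2; E_0], so that item k-1 of the list for n is
   E_(2(n+1)-2k). *)
Fixpoint even_euler_rev (n : nat) : seq rat :=
  if n is m.+1 then
    let s := even_euler_rev m in
    - (\sum_(1 <= k < n.+1) 'C(n.*2, k.*2)%:R * s`_(k.-1)) :: s
  else [:: 1].

Definition euler_num (n : nat) : rat :=
  if odd n then 0 else (even_euler_rev n./2)`_0.

Definition euler_poly (n : nat) : {poly rat} :=
  2%:R ^- n *: \sum_(k < n.+1)
    ('C(n, k)%:R * euler_num k) *: (2%:R *: 'X - 1) ^+ (n - k).

Lemma euler_num0 : euler_num 0 = 1.
Proof. by []. Qed.

Lemma euler_num_odd n : odd n -> euler_num n = 0.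
Proof. by rewrite /euler_num => ->. Qed.

Lemma nth_even_euler_rev n k : (k <= n)%N ->
  (even_euler_rev n)`_k = euler_num (n - k).*2.
Proof.
rewrite /euler_num odd_double doubleK; elim: n k => [|n IHn] [|k] //= le_kn.
by rewrite IHn // subSS.
Qed.

Lemma euler_num_even n : (0 < n)%N ->
  euler_num n.*2 =
    - \sum_(1 <= k < n.+1) 'C(n.*2, k.*2)%:R * euler_num (n.*2 - k.*2).
Proof.
case: n => // n _; rewrite {1}/euler_num odd_double doubleK [LHS]/=.
congr (- _); apply: eq_big_nat => -[|k] //= lt_kn.
by rewrite nth_even_euler_rev // -doubleB subSS.
Qed.

Lemma horner_euler_poly n x :
  (euler_poly n).[x] =
    2%:R ^- n * \sum_(k < n.+1)
      'C(n, k)%:R * (2%:R * x - 1) ^+ (n - k) * euler_num k.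
Proof.
rewrite /euler_poly hornerZ horner_sum; congr (_ * _); apply: eq_bigr => k _.
by rewrite hornerZ horner_exp hornerD hornerN hornerZ hornerX hornerC mulrAC.
Qed.

Lemma residueP p a r : prime p -> (r < p)%N ->
  eqmod_loc p p a r%:R -> residue p a = r.
Proof.
move=> p_pr lt_rp a_r.
have p_gt0 := prime_gt0 p_pr.
have has_r : has (fun r => eqmod_loc p p a r%:R) (iota 0 p).
  by apply/hasP; exists r; rewrite // mem_iota.
have lt_sp : (residue p a < p)%N by move: has_r; rewrite has_find size_iota.
have := nth_find 0%N has_r; rewrite -/(residue p a) nth_iota // add0n => a_s.
set s := residue p a in lt_sp a_s *.
have pn0 : p%:R != 0 :> rat by rewrite pnatr_eq0 -lt0n.
(* The difference z of the two quotients satisfies z * p = s - r. *)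
pose x := (a - r%:R) / p%:R : rat; pose y := (a - s%:R) / p%:R : rat.
have def_z : (s%:R - r%:R : rat) = (x - y) * p%:R.
  by rewrite /x /y -mulrBl divfK // opprB [RHS]addrC addrA subrK.
have coef_int (u : rat) : u * (denq u)%:~R = (numq u)%:~R.
  by rewrite -{1}[u]divq_num_den divfK // intr_eq0 denq_neq0.
have E : (s%:Z - r%:Z) * (denq x * denq y)
         = p%:Z * (numq x * denq y - numq y * denq x) :> int.
  apply: (@intr_inj rat); rewrite !(rmorphM, rmorphB) /= -!coef_int.
  rewrite -[(s%:Z)%:~R]/(s%:R : rat) -[(r%:Z)%:~R]/(r%:R : rat).
  rewrite -[(p%:Z)%:~R]/(p%:R : rat) def_z.
  rewrite -mulrA [_ * (_ * _)]mulrC -mulrA [_ * (x - y)]mulrC.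
  congr (_ * _); rewrite mulrBl mulrA; congr (_ - _).
  by rewrite mulrA mulrAC.
have : (p%:Z %| (s%:Z - r%:Z) * (denq x * denq y))%Z by rewrite E dvdz_mulr.
rewrite dvdzE !abszM /= !Euclid_dvdM // (negPf a_r) (negPf a_s) !orbF => dvd_p.
have : (s%:Z == r%:Z %[mod p])%Z by rewrite eqz_mod_dvd dvdzE.
by rewrite !modz_nat !modn_small // => /eqP[].
Qed.

(* For p = 3 and a = 4 the two sides of the first congruence are 33 and 6, so
   they agree only modulo 27. *)
Lemma first_congruence_fails_at_3 :
  ~~ eqmod_loc 3 (3 ^ 4)
      (\sum_(k < 3) (1 - 2%:R / 4%:R * k%:R) * gbinom 4%:R k ^+ 3)
      ((-1) ^+ residue 3 4%:R * ((4%:R - (residue 3 4%:R)%:R) / 4%:R)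
        + (4%:R - (residue 3 4%:R)%:R) ^+ 3 / 4%:R
          * (euler_poly (3 - 3)).[- 4%:R]).
Proof.
have -> : residue 3 4%:R = 1%N by apply: residueP.
by rewrite horner_euler_poly /gbinom !big_ord_recr !big_ord0.
Qed.

(* Main.v *)
Require Import Defs.
From mathcomp Require Import all_boot all_order all_algebra.
From mathcomp Require Import ring lra zify.

Import Order.TTheory GRing.Theory Num.Theory.
Local Open Scope ring_scope.

(* Let t = a - <a>_p and F(a) = sum_(k < p) (a - 2k) C(a,k)^3. The sum
   F(a) + F(a-1) telescopes to C(a-1,p-1)^3 (2a - p), and
   a C(a-1,p-1) = p C(a,p) = t mod p^2, so F(a) + F(a-1) = 2 t^3 / a^2 mod p^4.
   By E_n(x) + E_n(x+1) = 2 x^n and Fermat, (-1)^<a> t + t^3 E_(p-3)(-a)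
   satisfies the same recurrence, and induction on <a>_p reduces the first
   congruence to <a>_p = 0, where it follows from E_(p-3)(0) = 0. As this fails
   for p = 3, the induction is carried out for three times the congruence.
   The second congruence follows since
   (a - 2k)^3 + 3 a^2 (a - 2k) = 4 ((a - k)^3 - k^3), whose product with C(a,k)^3
   telescopes too. *)

Set Implicit Arguments.
Unset Strict Implicit.
Unset Printing Implicit Defensive.

(** * Divisibility by powers of p in Z_p *)

Section LocalRing.

Variable p : nat.
Hypothesis p_pr : prime p.

(** Any denominator prime to p will do, not only the reduced one, so sums and products need no
    reduction to lowest terms. *)
Lemma Zp_locP (x : rat) :
  reflect (exists u : int, exists2 d : nat, ~~ (p %| d)%N & x * d%:R = u%:~R)
          (x \in Zp_loc p).
Proof.
apply: (iffP idP) => [x_loc | [u [d p'd def_x]]].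
  exists (numq x), `|denq x|%N => //.
  have -> : (`|denq x|%N%:R : rat) = (denq x)%:~R.
    by rewrite -[_%:R]/(`|denq x|%N%:Z%:~R) gtz0_abs ?denq_gt0.
  by rewrite -{1}[x]divq_num_den divfK // intr_eq0 denq_neq0.
have E : numq x * d%:Z = u * denq x.
  apply: (@intr_inj rat); rewrite !rmorphM /= -def_x.
  rewrite -[d%:Z%:~R]/(d%:R : rat) -{2}[x]divq_num_den.
  by rewrite mulrAC divfK // intr_eq0 denq_neq0.
(* Being coprime to the numerator, the reduced denominator must divide d. *)
have : (`|denq x| %| `|numq x| * d)%N.
  by have := congr1 absz E; rewrite !abszM absz_nat => ->; apply: dvdn_mull.
rewrite Gauss_dvdr; last by rewrite coprime_sym coprime_num_den.
by move=> dv; apply: contra p'd => /dvdn_trans; apply.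
Qed.

(** Level 0 expresses integrality, and an integral x with [~~ Zp_dvd 1 x] is a unit of Z_p. *)
Definition Zp_dvd (k : nat) (x : rat) := x / p%:R ^+ k \in Zp_loc p.

Let p_n0 : p%:R != 0 :> rat.
Proof. by rewrite pnatr_eq0 -lt0n prime_gt0. Qed.

Let pX_n0 k : p%:R ^+ k != 0 :> rat.
Proof. by rewrite expf_neq0. Qed.

Lemma eqmod_loc_dvd k x y : eqmod_loc p (p ^ k) x y = Zp_dvd k (x - y).
Proof. by rewrite /eqmod_loc /Zp_dvd natrX. Qed.

Lemma Zp_dvd0E x : Zp_dvd 0 x = (x \in Zp_loc p).
Proof. by rewrite /Zp_dvd expr0 divr1. Qed.

Lemma Zp_dvd_int (z : int) : Zp_dvd 0 z%:~R.
Proof.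
rewrite Zp_dvd0E; apply/Zp_locP; exists z, 1%N; rewrite ?mulr1 //.
by rewrite dvdn1; case: eqP p_pr => // ->.
Qed.

Lemma Zp_dvd_nat (n : nat) : Zp_dvd 0 n%:R.
Proof. exact: (Zp_dvd_int n%:Z). Qed.

Lemma Zp_dvdD k x y : Zp_dvd k x -> Zp_dvd k y -> Zp_dvd k (x + y).
Proof.
move=> /Zp_locP[u [d p'd xE]] /Zp_locP[v [e p'e yE]]; apply/Zp_locP.
exists (u * e%:Z + v * d%:Z), (d * e)%N; first by rewrite Euclid_dvdM // negb_or p'd.
rewrite mulrDl natrM rmorphD !rmorphM /= -xE -yE.
by rewrite -[d%:Z%:~R]/(d%:R : rat) -[e%:Z%:~R]/(e%:R : rat); ring.
Qed.

Lemma Zp_dvdM j k x y : Zp_dvd j x -> Zp_dvd k y -> Zp_dvd (j + k) (x * y).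
Proof.
move=> /Zp_locP[u [d p'd xE]] /Zp_locP[v [e p'e yE]]; apply/Zp_locP.
exists (u * v), (d * e)%N; first by rewrite Euclid_dvdM // negb_or p'd.
by rewrite natrM rmorphM /= -xE -yE exprD invfM; ring.
Qed.

Lemma Zp_dvdMl k x y : Zp_dvd 0 x -> Zp_dvd k y -> Zp_dvd k (x * y).
Proof. exact: Zp_dvdM. Qed.

Lemma Zp_dvdMr k x y : Zp_dvd k x -> Zp_dvd 0 y -> Zp_dvd k (x * y).
Proof. by rewrite mulrC => x_k y_0; apply: Zp_dvdMl. Qed.

Lemma Zp_dvdN k x : Zp_dvd k x -> Zp_dvd k (- x).
Proof. by rewrite -mulN1r; apply: Zp_dvdMl; apply: (Zp_dvd_int (-1)). Qed.

Lemma Zp_dvdB k x y : Zp_dvd k x -> Zp_dvd k y -> Zp_dvd k (x - y).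
Proof. by move=> x_k /Zp_dvdN; apply: Zp_dvdD. Qed.

Lemma Zp_dvdp_exp k : Zp_dvd k (p%:R ^+ k).
Proof. by rewrite /Zp_dvd divff // -Zp_dvd0E; apply: (Zp_dvd_nat 1). Qed.

Lemma Zp_dvdp : Zp_dvd 1 p%:R.
Proof. exact: (Zp_dvdp_exp 1). Qed.

Lemma Zp_dvdW j k x : (j <= k)%N -> Zp_dvd k x -> Zp_dvd j x.
Proof.
move=> le_jk x_k; rewrite -(divfK (pX_n0 k) x).
rewrite -[X in _ * _ ^+ X](subnKC le_jk) exprD mulrCA.
apply: Zp_dvdMr (Zp_dvdp_exp j) _; apply: Zp_dvdMl; first by rewrite Zp_dvd0E.
by rewrite -natrX Zp_dvd_nat.
Qed.

Lemma Zp_dvd00 k : Zp_dvd k 0.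
Proof. by rewrite /Zp_dvd mul0r -Zp_dvd0E (Zp_dvd_nat 0). Qed.

Lemma Zp_dvdX k x n : Zp_dvd k x -> Zp_dvd (k * n) (x ^+ n).
Proof.
move=> x_k; elim: n => [|n IHn]; first by rewrite muln0 (Zp_dvd_nat 1).
by rewrite mulnS exprS; apply: Zp_dvdM.
Qed.

Lemma Zp_dvd0X x n : Zp_dvd 0 x -> Zp_dvd 0 (x ^+ n).
Proof. exact: (@Zp_dvdX 0). Qed.

Lemma Zp_dvd_sum k (I : Type) (r : seq I) (P : pred I) (F : I -> rat) :
  (forall i, P i -> Zp_dvd k (F i)) -> Zp_dvd k (\sum_(i <- r | P i) F i).
Proof.
by move=> F_k; apply: (big_ind (Zp_dvd k)) => //; [apply: Zp_dvd00 | apply: Zp_dvdD].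
Qed.

(** If x = u / d with p not dividing d, then p does not divide u, since x / p would be integral
    otherwise; hence d / u is integral. *)
Lemma Zp_unitV x : Zp_dvd 0 x -> ~~ Zp_dvd 1 x -> Zp_dvd 0 x^-1.
Proof.
rewrite Zp_dvd0E => /Zp_locP[u [d p'd xE]] x_unit.
have p'u : ~~ (p %| `|u|)%N.
  apply: contra x_unit => /dvdnP[q def_u].
  apply/Zp_locP; exists (sgz u * q%:Z), d => //.
  rewrite expr1 mulrAC xE [u in LHS]intEsg def_u PoszM !rmorphM /=.
  by rewrite mulrA mulfK.
have d_n0 : d%:R != 0 :> rat by rewrite pnatr_eq0; apply: contraNneq p'd => ->.
have u_n0 : u%:~R != 0 :> rat by rewrite intr_eq0; apply: contraNneq p'u => ->.
rewrite Zp_dvd0E; apply/Zp_locP; exists (sgz u * d%:Z), `|u|%N => //.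
have -> : x = u%:~R / d%:R by rewrite -xE mulfK.
have -> : (`|u|%N%:R : rat) = (sgz u)%:~R * u%:~R.
  by rewrite -rmorphM /= -abszEsg.
by rewrite invf_div rmorphM /= mulrCA divfK.
Qed.

Lemma Zp_dvd_cancel k u x :
  Zp_dvd 0 u -> ~~ Zp_dvd 1 u -> Zp_dvd k (u * x) -> Zp_dvd k x.
Proof.
move=> u_0 u_unit ux_k; have u_n0: u != 0.
  by apply: contraNneq u_unit => ->; apply: Zp_dvd00.
by rewrite -(mulKf u_n0 x); apply: Zp_dvdMl ux_k; apply: Zp_unitV.
Qed.

Lemma Zp_dvd1_nat n : Zp_dvd 1 n%:R = (p %| n)%N.
Proof.
apply/idP/idP => [|/dvdnP[q ->]]; last first.
  by rewrite natrM; apply: Zp_dvdMl Zp_dvdp; apply: Zp_dvd_nat.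
case/Zp_locP=> u [d p'd]; rewrite expr1 => nE.
have : (n * d)%N%:Z = u * p%:Z.
  apply: (@intr_inj rat); rewrite -[LHS]/((n * d)%N%:R : rat) intrM -nE.
  by rewrite -[p%:Z%:~R]/(p%:R : rat) natrM mulrAC divfK.
move/(congr1 absz); rewrite abszM !absz_nat => nd.
have : (p %| n * d)%N by rewrite nd dvdn_mull.
by rewrite Euclid_dvdM // (negPf p'd) orbF.
Qed.

Lemma Zp_unit_nat k : (0 < k < p)%N -> ~~ Zp_dvd 1 k%:R.
Proof.
by case/andP=> k_gt0 lt_kp; rewrite Zp_dvd1_nat gtnNdvd.
Qed.

Lemma Zp_unitX x n : Zp_dvd 0 x -> ~~ Zp_dvd 1 x -> ~~ Zp_dvd 1 (x ^+ n).
Proof.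
move=> x_0 x_unit; elim: n => [|n IHn]; first by rewrite (@Zp_unit_nat 1) ?prime_gt1.
by apply: contra IHn; rewrite exprS; apply: Zp_dvd_cancel.
Qed.

Lemma Zp_congX k x y n : Zp_dvd 0 x -> Zp_dvd 0 y ->
  Zp_dvd k (x - y) -> Zp_dvd k (x ^+ n - y ^+ n).
Proof.
move=> x_0 y_0 xy; rewrite subrXX; apply: Zp_dvdMr xy _; apply: Zp_dvd_sum => i _.
by apply: Zp_dvdMl; apply: Zp_dvd0X.
Qed.

(** Fermat's little theorem passes from n to x: modulo p, x^p = n^p = n = x. *)
Lemma Zp_fermat x (n : nat) : Zp_dvd 0 x ->
  Zp_dvd 1 (x - n%:R) -> Zp_dvd 1 (x ^+ p - x).
Proof.
move=> x_0 xn; rewrite -(subrK (n%:R ^+ p) (x ^+ p)) -addrA; apply: Zp_dvdD.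
  by apply: Zp_congX => //; apply: Zp_dvd_nat.
rewrite -(subrK n%:R (_ ^+ p)) -addrA; apply: Zp_dvdD; last first.
  by rewrite -opprB; apply: Zp_dvdN.
(* This keeps the natural subtraction n^p - n from being truncated. *)
have le_n : (n <= n ^ p)%N.
  case: n {xn} => [|n]; first by [].
  have p_gt0 := prime_gt0 p_pr.
  by rewrite -[X in (X <= _)%N]expn1 leq_pexp2l.
rewrite -natrX -natrB // Zp_dvd1_nat -eqn_mod_dvd //.
by apply/eqP/fermat_little.
Qed.

End LocalRing.

(* Otherwise unification unfolds [Zp_dvd] and computes with rationals. *)
Opaque Zp_dvd.

(** * Euler numbers and the functional equation of the Euler polynomials *)

Lemma bin_mulC m k i : ('C(m, k) * 'C(m - k, i) = 'C(m, i) * 'C(m - i, k))%N.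
Proof.
have [le_kim | lt_mki] := leqP (k + i) m; last first.
  have bin0 n j l : (n < j + l)%N -> ('C(n, j) * 'C(n - j, l) = 0)%N.
    move=> lt_n; have [lt_nj | le_jn] := ltnP n j; first by rewrite bin_small.
    by rewrite [X in (_ * X)%N]bin_small ?muln0 //; lia.
  by rewrite !bin0 // addnC.
(* Multiplied by these factorials, both sides become m!. *)
have fk : (0 < k`! * i`! * (m - k - i)`!)%N by rewrite !muln_gt0 !fact_gt0.
apply/eqP; rewrite -(eqn_pmul2r fk); apply/eqP.
have -> : ('C(m, k) * 'C(m - k, i) * (k`! * i`! * (m - k - i)`!)
  = 'C(m, k) * (k`! * ('C(m - k, i) * (i`! * (m - k - i)`!))))%N by ring.
have -> : ('C(m, i) * 'C(m - i, k) * (k`! * i`! * (m - k - i)`!)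
  = 'C(m, i) * (i`! * ('C(m - i, k) * (k`! * (m - k - i)`!))))%N by ring.
rewrite (subnAC m k i) [in RHS]bin_fact 1?subnAC ?bin_fact //; lia.
Qed.

Lemma sum_odd0 (V : nmodType) (f : nat -> V) N :
  (forall k, odd k -> f k = 0) ->
  \sum_(k < N.*2.+1) f k = \sum_(k < N.+1) f k.*2.
Proof.
move=> f_odd; elim: N => [|N IHN]; first by rewrite !big_ord1.
rewrite doubleS !big_ord_recr /= in IHN *; rewrite -IHN.
by rewrite [f _.+1]f_odd ?addr0 //= odd_double.
Qed.

(** This is the coefficient form of (e^t + e^-t) * sum E_n t^n / n! = 2. For odd n each term
    vanishes, either because n - k is odd or because E_k = 0; for even n > 0 it is the defining
    recurrence. *)
Lemma euler_num_rec n :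
  \sum_(k < n.+1) 'C(n, k)%:R * euler_num k * ((-1) ^+ (n - k) + 1)
    = (n == 0)%:R * 2%:R.
Proof.
have [odd_n | even_n] := boolP (odd n).
  rewrite (negPf (_ : n != 0%N)); last by case: n odd_n.
  rewrite mul0r big1 // => -[k /= lt_k] _.
  have [odd_k | even_k] := boolP (odd k); first by rewrite euler_num_odd // mulr0 mul0r.
  by rewrite -signr_odd oddB // odd_n (negPf even_k) addNr mulr0.
have := even_halfK even_n; move: n./2 => N <-.
rewrite (@sum_odd0 _ (fun k => 'C(N.*2, k)%:R * euler_num k * ((-1) ^+ (N.*2 - k) + 1)));
  last by move=> k odd_k; rewrite euler_num_odd // mulr0 mul0r.
under eq_bigr => k _ do
  rewrite -doubleB -signr_odd odd_double -[_ ^+ false + 1]/(2%:R).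
rewrite -mulr_suml; congr (_ * _); case: N => [|N]; first by rewrite big_ord1.
rewrite double_eq0 /=.
(* Reversal matches the indexing of the recurrence, and the term that comes first is then the Euler
   number of highest index. *)
rewrite -(big_mkord xpredT (fun k => 'C(N.+1.*2, k.*2)%:R * euler_num k.*2)) big_nat_rev.
rewrite big_ltn //= add0n !subSS subn0 binn mul1r euler_num_even // addrC.
apply/eqP; rewrite subr_eq0; apply/eqP; apply: eq_big_nat => k /andP[_ lt_k].
by rewrite subSS -doubleB -[in RHS]bin_sub ?leq_double // -doubleB.
Qed.

(** At z = 2x - 1 this is 2^m E_m(x). Raising x by 1 raises z by 2, whence the symmetric shifts z -
    1 and z + 1 below. *)
Definition euler_sum (m : nat) (z : rat) : rat :=
  \sum_(k < m.+1) 'C(m, k)%:R * z ^+ (m - k) * euler_num k.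

Lemma horner_euler_sum m x :
  (euler_poly m).[x] = 2%:R ^- m * euler_sum m (2%:R * x - 1).
Proof. exact: horner_euler_poly. Qed.

(** Expanding in powers of z and exchanging the sums by [bin_mulC], the coefficient of z^i contains
    the sum of [euler_num_rec] for n = m - i, which vanishes unless i = m. *)
Lemma euler_sum_shift m z :
  euler_sum m (z - 1) + euler_sum m (z + 1) = 2%:R * z ^+ m.
Proof.
have expand (n : nat) : (n <= m)%N ->
  (z - 1) ^+ n + (z + 1) ^+ n
    = \sum_(i < m.+1) 'C(n, i)%:R * z ^+ i * ((-1) ^+ (n - i) + 1).
  move=> le_nm; rewrite [z - 1]addrC [z + 1]addrC !exprDn -big_split /=.
  (* Vanishing binomials pad the range to one independent of n, so that the two sums can be
     exchanged. *)
  rewrite (big_ord_widen m.+1 (fun i => (-1) ^+ (n - i) * z ^+ i *+ 'C(n, i)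
    + 1 ^+ (n - i) * z ^+ i *+ 'C(n, i))) // big_mkcond /=; apply: eq_bigr => i _.
  case: ifP => [_ | /negbT]; first last.
    by rewrite ltnS -ltnNge => lt_ni; rewrite bin_small // !mul0r.
  rewrite expr1n -mulrnDl -[LHS]mulr_natl.
  by move: ((-1) ^+ (n - i)) (z ^+ i) ('C(n, i)%:R) => s w c; ring.
rewrite /euler_sum -big_split /=.
under eq_bigr => k _.
  rewrite -mulrDl -mulrDr expand ?leq_subr // mulrAC mulr_sumr.
  under eq_bigr => i _.
    have -> : 'C(m, k)%:R * euler_num k * ('C(m - k, i)%:R * z ^+ i * ((-1) ^+ (m - k - i) + 1))
      = 'C(m, i)%:R * z ^+ i * ('C(m - i, k)%:R * euler_num k * ((-1) ^+ (m - i - k) + 1)).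
      have := congr1 (fun n => n%:R : rat) (bin_mulC m k i).
      rewrite !natrM (subnAC m k i).
      move: 'C(m, k)%:R 'C(m - k, i)%:R 'C(m, i)%:R 'C(m - i, k)%:R.
      move: ((-1) ^+ _) (z ^+ i) (euler_num k) => s w e u v u' v' uv.
      transitivity (u * v * (e * w * (s + 1))); first by ring.
      by rewrite uv; ring.
    over.
  over.
rewrite exchange_big /=.
under eq_bigr => i _.
  rewrite -mulr_sumr.
  have -> : \sum_(k < m.+1) 'C(m - i, k)%:R * euler_num k * ((-1) ^+ (m - i - k) + 1)
      = (m - i == 0)%N%:R * 2%:R.
    rewrite -euler_num_rec [RHS](big_ord_widen m.+1 (fun k => 'C(m - i, k)%:R * euler_num k
      * ((-1) ^+ (m - i - k) + 1))) ?ltnS ?leq_subr // [RHS]big_mkcond /=.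
    apply: eq_bigr => k _; case: ifP => // /negbT; rewrite ltnS -ltnNge => lt_k.
    by rewrite bin_small // !mul0r.
  over.
rewrite big_ord_recr /= subnn binn mul1r mulrC big1 ?add0r // => i _.
by rewrite subn_eq0 leqNgt ltn_ord mulr0.
Qed.

Lemma euler_polyD1 m x :
  (euler_poly m).[x] + (euler_poly m).[x + 1] = 2%:R * x ^+ m.
Proof.
rewrite !horner_euler_sum -mulrDr.
have -> : 2%:R * (x + 1) - 1 = 2%:R * x + 1 by ring.
by rewrite euler_sum_shift exprMn mulrCA mulKf // expf_neq0.
Qed.

(** The points x = 0 and x = 1 correspond to z = -1 and z = 1. Wherever E_k is nonzero, m - k is
    even, so the two values agree, while their sum is 2 * 0^m = 0. *)
Lemma euler_poly_eval0 m : (0 < m)%N -> ~~ odd m -> (euler_poly m).[0] = 0.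
Proof.
move=> m_gt0 even_m; have := euler_polyD1 m 0.
rewrite !horner_euler_sum expr0n -(negbK (m == 0%N)) -lt0n m_gt0 /= mulr0 => E0.
have E01 : euler_sum m (2 * 0 - 1) = euler_sum m (2 * (0 + 1) - 1).
  apply: eq_bigr => -[k /= lt_k] _.
  have [odd_k | even_k] := boolP (odd k); first by rewrite euler_num_odd // !mulr0.
  have -> : 2 * (0 + 1) - 1 = 1 :> rat by [].
  have -> : 2 * 0 - 1 = - 1 :> rat by [].
  by rewrite -signr_odd oddB // (negPf even_m) (negPf even_k) expr1n.
by move: E0; rewrite -E01; set u := _ * _; lra.
Qed.

(** * Integrality of Euler numbers and polynomials at p *)

Section EulerIntegrality.

Variable p : nat.
Hypotheses (p_pr : prime p) (p_odd : odd p).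

Lemma Zp_euler_num n : Zp_dvd p 0 (euler_num n).
Proof.
elim/ltn_ind: n => n IHn.
have [odd_n | even_n] := boolP (odd n); first by rewrite euler_num_odd // Zp_dvd00.
have := even_halfK even_n; case: n./2 IHn => [|N] IHn def_n.
  by rewrite -def_n (Zp_dvd_nat _ 1).
rewrite -def_n euler_num_even //; apply: Zp_dvdN => //.
rewrite big_nat; apply: Zp_dvd_sum => // k /andP[k_gt0 _].
apply: Zp_dvdMl; rewrite ?Zp_dvd_nat //; apply: IHn; rewrite -def_n; lia.
Qed.

Lemma Zp_unit2 : ~~ Zp_dvd p 1 2%:R.
Proof.
by apply: (@Zp_unit_nat _ p_pr 2); rewrite odd_prime_gt2.
Qed.

(** Clears the denominator 2^m of an Euler polynomial; 2 is a unit because p is odd. *)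
Lemma Zp_dvd_cancel2X m k x : Zp_dvd p k (2%:R ^+ m * x) -> Zp_dvd p k x.
Proof.
have z2 := Zp_dvd_nat p_pr 2.
exact: (Zp_dvd_cancel p_pr (Zp_dvd0X p_pr m z2) (Zp_unitX p_pr m z2 Zp_unit2)).
Qed.

Lemma Zp_euler_poly m x : Zp_dvd p 0 x -> Zp_dvd p 0 (euler_poly m).[x].
Proof.
move=> x_0; apply: (@Zp_dvd_cancel2X m).
rewrite horner_euler_sum mulVKf ?expf_neq0 //; apply: Zp_dvd_sum => // k _.
have Nz := Zp_dvd_nat p_pr.
apply: Zp_dvdMl (Zp_euler_num _) => //; apply: Zp_dvdMl => //; apply: Zp_dvd0X => //.
by apply: Zp_dvdB; rewrite ?(Nz 1) //; apply: Zp_dvdMl.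
Qed.

Lemma Zp_euler_poly_cong m k x y : Zp_dvd p 0 x -> Zp_dvd p 0 y ->
  Zp_dvd p k (x - y) -> Zp_dvd p k ((euler_poly m).[x] - (euler_poly m).[y]).
Proof.
move=> x_0 y_0 xy; apply: (@Zp_dvd_cancel2X m).
rewrite !horner_euler_sum -mulrBr mulVKf ?expf_neq0 //.
rewrite /euler_sum -sumrB; apply: Zp_dvd_sum => // i _.
have Nz := Zp_dvd_nat p_pr.
rewrite -mulrBl -mulrBr; apply: Zp_dvdMr (Zp_euler_num _) => //; apply: Zp_dvdMl => //.
have lin (u : rat) : Zp_dvd p 0 u -> Zp_dvd p 0 (2%:R * u - 1).
  by move=> u_0; apply: Zp_dvdB; rewrite ?(Nz 1) //; apply: Zp_dvdMl.
apply: Zp_congX; rewrite ?lin //.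
have -> : 2%:R * x - 1 - (2%:R * y - 1) = 2%:R * (x - y) by ring.
exact: Zp_dvdMl.
Qed.

End EulerIntegrality.

(** * General binomial coefficients and the telescoping sums *)

Lemma gbinom0 a : gbinom a 0 = 1.
Proof. by rewrite /gbinom big_ord0 fact0 divr1. Qed.

Lemma mul_gbinomS a k :
  k.+1%:R * gbinom a k.+1 = (a - k%:R) * gbinom a k.
Proof.
have nz n : n`!%:R != 0 :> rat by rewrite pnatr_eq0 -lt0n fact_gt0.
have kn : k.+1%:R != 0 :> rat by rewrite pnatr_eq0.
rewrite /gbinom big_ord_recr /= factS natrM.
move: (\prod_(_ < _) _) (k.+1%:R) (k`!%:R) kn (nz k) => P u v u_n0 v_n0.
by field; rewrite u_n0 v_n0.
Qed.

Lemma mul_gbinom_pred a k : a * gbinom (a - 1) k = (a - k%:R) * gbinom a k.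
Proof.
elim: k => [|k IHk]; first by rewrite !gbinom0 subr0.
have kn : k.+1%:R != 0 :> rat by rewrite pnatr_eq0.
apply: (mulfI kn); rewrite mulrCA mul_gbinomS mulrCA IHk [in RHS]mulrCA mul_gbinomS.
by rewrite -natr1; ring.
Qed.

Lemma mul_gbinom_diag a k : k.+1%:R * gbinom a k.+1 = a * gbinom (a - 1) k.
Proof. by rewrite mul_gbinomS mul_gbinom_pred. Qed.

(** At m = p this is a times the first sum of the theorem, free of the division by a. *)
Definition cube_sum m a : rat := \sum_(k < m) (a - 2%:R * k%:R) * gbinom a k ^+ 3.

(** The factor a^3 turns C(a-1,k)^3 into ((a-k) C(a,k))^3, which is also ((k+1) C(a,k+1))^3, so that
    the terms are differences of [G]. *)
Lemma cube_sum_rec m a :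
  a ^+ 3 * (cube_sum m a + cube_sum m (a - 1))
    = (m%:R * gbinom a m) ^+ 3 * (2%:R * a - m%:R).
Proof.
pose G k : rat := (k%:R * gbinom a k) ^+ 3 * (2%:R * a - k%:R).
have -> : (m%:R * gbinom a m) ^+ 3 * (2%:R * a - m%:R) = G m - G 0%N.
  have -> : G 0%N = 0 by rewrite /G !mul0r.
  by rewrite subr0.
rewrite -telescope_sumr // big_mkord -big_split mulr_sumr; apply: eq_bigr => k _ /=.
rewrite /G mul_gbinomS; have := mul_gbinom_pred a k.
set u := gbinom a k; set v := gbinom (a - 1) k => uv.
have -> : a ^+ 3 * ((a - 2 * k%:R) * u ^+ 3 + (a - 1 - 2 * k%:R) * v ^+ 3)
  = a ^+ 3 * ((a - 2 * k%:R) * u ^+ 3) + (a - 1 - 2 * k%:R) * (a * v) ^+ 3 by ring.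
by rewrite uv -natr1; ring.
Qed.

Lemma sum_cube_gbinom_cube m a :
  \sum_(k < m) (a - 2%:R * k%:R) ^+ 3 * gbinom a k ^+ 3 + 3%:R * a ^+ 2 * cube_sum m a
    = 4%:R * (m%:R * gbinom a m) ^+ 3.
Proof.
pose G k : rat := 4%:R * (k%:R * gbinom a k) ^+ 3.
have -> : 4%:R * (m%:R * gbinom a m) ^+ 3 = G m - G 0%N.
  have -> : G 0%N = 0 by rewrite /G !mul0r !mulr0.
  by rewrite subr0.
rewrite -telescope_sumr // big_mkord mulr_sumr -big_split; apply: eq_bigr => k _ /=.
by rewrite /G mul_gbinomS; ring.
Qed.

(** * Congruences for binomial coefficients and for the cube sum *)

Section Congruences.

Variable p : nat.
Hypotheses (p_pr : prime p) (p_odd : odd p).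

Let Nz n : Zp_dvd p 0 n%:R.
Proof. exact: Zp_dvd_nat. Qed.

Lemma Zp_dvd0W k x : Zp_dvd p k x -> Zp_dvd p 0 x.
Proof. exact: Zp_dvdW. Qed.

Lemma Zp_congM k x x' y y' : Zp_dvd p 0 x' -> Zp_dvd p 0 y ->
  Zp_dvd p k (x - x') -> Zp_dvd p k (y - y') -> Zp_dvd p k (x * y - x' * y').
Proof.
move=> x'_0 y_0 xx' yy'; have -> : x * y - x' * y' = (x - x') * y + x' * (y - y') by ring.
by apply: Zp_dvdD => //; [apply: Zp_dvdMr | apply: Zp_dvdMl].
Qed.

Lemma Zp_cong0 k x y : Zp_dvd p k (x - y) -> Zp_dvd p k y -> Zp_dvd p k x.
Proof. by move=> xy y_k; rewrite -(subrK y x); apply: Zp_dvdD. Qed.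

(** The cofactor x^2 + xy + y^2 is itself divisible by p^2, which doubles the precision. *)
Lemma Zp_cong_cube x y : Zp_dvd p 2 (x - y) -> Zp_dvd p 1 y ->
  Zp_dvd p 4 (x ^+ 3 - y ^+ 3).
Proof.
move=> xy y_1; have x_1 : Zp_dvd p 1 x by apply: Zp_cong0 y_1; apply: Zp_dvdW xy.
have -> : x ^+ 3 - y ^+ 3 = (x - y) * (x * x + x * y + y * y) by ring.
by apply: (Zp_dvdM p_pr xy); rewrite !Zp_dvdD //; apply: (@Zp_dvdM _ p_pr 1 1).
Qed.

Section NearZero.

Variable t : rat.
Hypothesis t_1 : Zp_dvd p 1 t.

Let t_0 : Zp_dvd p 0 t.
Proof. exact: Zp_dvd0W t_1. Qed.

(** Modulo p the upper index is -1, and C(-1,k) = (-1)^k; the bound on k keeps the denominators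
    invertible. *)
Lemma gbinom_pred_cong k : (k < p)%N -> Zp_dvd p 1 (gbinom (t - 1) k - (-1) ^+ k).
Proof.
elim: k => [|k IHk] lt_kp; first by rewrite gbinom0 subrr Zp_dvd00.
have kp := ltnW lt_kp; have {}IHk := IHk kp.
apply: (@Zp_dvd_cancel _ p_pr 1 k.+1%:R); rewrite ?Zp_unit_nat //.
rewrite mulrBr mul_gbinomS exprS.
have -> : (t - 1 - k%:R) * gbinom (t - 1) k - k.+1%:R * (-1 * (-1) ^+ k)
   = t * (gbinom (t - 1) k - (-1) ^+ k) + t * (-1) ^+ k
     - k.+1%:R * (gbinom (t - 1) k - (-1) ^+ k) by rewrite -natr1; ring.
have s_0 : Zp_dvd p 0 ((-1) ^+ k).
  by apply: Zp_dvd0X => //; apply: Zp_dvdN => //; apply: (Nz 1).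
apply: Zp_dvdB => //; first apply: Zp_dvdD => //.
- exact: Zp_dvdMl.
- exact: Zp_dvdMr.
- exact: Zp_dvdMl.
Qed.

(** For n = 0 the product is t C(t-1,p-1), with C(t-1,p-1) = (-1)^(p-1) = 1 mod p. Raising n by 1
    multiplies it by a / (a - p) with a = t + n + 1 a unit, which changes it only modulo p^2. *)
Lemma gbinom_p_cong n : (n < p)%N ->
  Zp_dvd p 2 (p%:R * gbinom (t + n%:R) p - t).
Proof.
have p_gt0 := prime_gt0 p_pr.
elim: n => [|n IHn] lt_np.
  rewrite addr0 -{2 3}(prednK p_gt0) mul_gbinom_diag -{3}[t]mulr1 -mulrBr.
  have := @gbinom_pred_cong p.-1; rewrite prednK // => /(_ (leqnn _)).
  rewrite -signr_odd -subn1 oddB // p_odd /= expr0; exact: Zp_dvdM t_1.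
have {}IHn := IHn (ltnW lt_np); set V := p%:R * _ in IHn.
have V_1 : Zp_dvd p 1 V by apply: Zp_cong0 t_1; apply: Zp_dvdW IHn.
apply: (@Zp_dvd_cancel _ p_pr 2 (t + n.+1%:R - p%:R)).
- by apply: Zp_dvdB => //; apply: Zp_dvdD.
- apply/negP => bad; have /negP[] := @Zp_unit_nat _ p_pr n.+1 lt_np.
  have -> : n.+1%:R = (t + n.+1%:R - p%:R) - t + p%:R :> rat by ring.
  by apply: Zp_dvdD (Zp_dvdp _) => //; apply: Zp_dvdB.
have := mul_gbinom_pred (t + n.+1%:R) p.
have -> : t + n.+1%:R - 1 = t + n%:R by rewrite -natr1; ring.
move=> pred_eq.
have -> : (t + n.+1%:R - p%:R) * (p%:R * gbinom (t + n.+1%:R) p - t)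
  = (t + n.+1%:R) * (V - t) + p%:R * t.
  by rewrite mulrBr mulrCA -pred_eq /V; ring.
apply: Zp_dvdD => //; first by apply: Zp_dvdMl => //; rewrite Zp_dvdD.
exact: (Zp_dvdM p_pr (Zp_dvdp p_pr) t_1).
Qed.

(** The term k = 0 is t, and C(t,k+1) = t C(t-1,k) / (k+1) extracts t^3 from all others; it remains
    to gain one more p from the sum of the [h k]. *)
Lemma cube_sum_near0 : Zp_dvd p 4 (cube_sum p t - t).
Proof.
have p_gt0 := prime_gt0 p_pr.
pose h k : rat := (t - 2%:R * k.+1%:R) * (gbinom (t - 1) k / k.+1%:R) ^+ 3.
have -> : cube_sum p t - t = t ^+ 3 * \sum_(k < p.-1) h k.
  rewrite /cube_sum -(prednK p_gt0) /= big_ord_recl /= gbinom0 mulr0 subr0 expr1n mulr1.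
  rewrite addrC addKr mulr_sumr; apply: eq_bigr => k _ /=; rewrite /bump add1n.
  have kn : k.+1%:R != 0 :> rat by rewrite pnatr_eq0.
  have := mul_gbinom_diag t k; rewrite /h => E.
  have -> : gbinom t k.+1 = t * (gbinom (t - 1) k / k.+1%:R).
    by apply: (mulfI kn); rewrite E [RHS]mulrCA [X in _ = _ * X]mulrC divfK.
  ring.
apply: (@Zp_dvdM _ p_pr 3 1); first exact: (Zp_dvdX p_pr 3 t_1).
apply: (Zp_dvd_cancel p_pr (Nz 2) (Zp_unit2 p_pr p_odd)).
(* The terms of indices k + 1 and p - (k + 1) cancel modulo p. *)
have -> : 2%:R * \sum_(k < p.-1) h k = \sum_(k < p.-1) (h k + h (p.-1 - k.+1)%N).
  rewrite big_split /= mulr_natl mulr2n; congr (_ + _).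
  by rewrite -(big_mkord xpredT h) big_nat_rev big_mkord.
apply: Zp_dvd_sum => // -[k /= lt_k] _.
set l := (p.-1 - k.+1)%N; have lt_kp : (k.+1 < p)%N by lia.
have lt_lp : (l.+1 < p)%N by rewrite /l; lia.
have gk := gbinom_pred_cong (ltnW lt_kp); have gl := gbinom_pred_cong (ltnW lt_lp).
have lE : l.+1%:R = p%:R - k.+1%:R :> rat by rewrite -natrB 1?ltnW //; congr _%:R; rewrite /l; lia.
have sgn : (-1) ^+ l = - (-1) ^+ k :> rat.
  rewrite -signr_odd -[in RHS]signr_odd; have -> : odd l = ~~ odd k by rewrite /l; lia.
  by case: (odd k); rewrite ?opprK.
have s_0 : Zp_dvd p 0 ((-1) ^+ k).
  by apply: Zp_dvd0X => //; apply: Zp_dvdN => //; apply: (Nz 1).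
rewrite {}sgn in gl; move: gk gl; rewrite /h.
have kn : k.+1%:R != 0 :> rat by rewrite pnatr_eq0.
have ln : l.+1%:R != 0 :> rat by rewrite pnatr_eq0.
have uk := @Zp_unit_nat _ p_pr k.+1 lt_kp; have ul := @Zp_unit_nat _ p_pr l.+1 lt_lp.
move: (Nz k.+1) (Nz l.+1) lE uk ul kn ln s_0.
set x := k.+1%:R; set y := l.+1%:R; set s := _ ^+ k.
set g := gbinom _ k; set g' := gbinom _ l => x_0 y_0 yE x_u y_u x_n0 y_n0 s_0 gs g's.
clearbody x y s g g'.
have g_0 : Zp_dvd p 0 g by apply: Zp_cong0 s_0; apply: Zp_dvd0W gs.
have Ns_0 : Zp_dvd p 0 (- s) by apply: Zp_dvdN.
have Nx_0 : Zp_dvd p 0 (- x) by apply: Zp_dvdN.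
have g'_0 : Zp_dvd p 0 g' by apply: Zp_cong0 Ns_0; apply: Zp_dvd0W g's.
have X_0 : Zp_dvd p 0 ((x * y) ^+ 3) by apply: Zp_dvd0X => //; apply: Zp_dvdMl.
have X_u : ~~ Zp_dvd p 1 ((x * y) ^+ 3).
  apply: Zp_unitX => //; first exact: Zp_dvdMl.
  by apply: contra y_u => xy_1; apply: (Zp_dvd_cancel p_pr x_0 x_u).
apply: (Zp_dvd_cancel p_pr X_0 X_u).
(* The two subtracted products are the values modulo p, obtained from t = 0, y = -x, g = s and g' =
   -s; they cancel each other. *)
have -> : (x * y) ^+ 3 * ((t - 2 * x) * (g / x) ^+ 3 + (t - 2 * y) * (g' / y) ^+ 3)
  = ((y ^+ 3 * (t - 2%:R * x)) * g ^+ 3 - ((- x) ^+ 3 * (- (2%:R * x))) * s ^+ 3)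
    + ((x ^+ 3 * (t - 2%:R * y)) * g' ^+ 3 - (x ^+ 3 * (2%:R * x)) * (- s) ^+ 3).
  by field; rewrite x_n0 y_n0.
have p_1 := Zp_dvdp p_pr.
have x2_0 : Zp_dvd p 0 (2%:R * x) by apply: Zp_dvdMl.
have y2_0 : Zp_dvd p 0 (2%:R * y) by apply: Zp_dvdMl.
have y3_0 : Zp_dvd p 0 (y ^+ 3) by apply: Zp_dvd0X.
have x3_0 : Zp_dvd p 0 (x ^+ 3) by apply: Zp_dvd0X.
have Nx3_0 : Zp_dvd p 0 ((- x) ^+ 3) by apply: Zp_dvd0X.
have Nx2_0 : Zp_dvd p 0 (- (2%:R * x)) by apply: Zp_dvdN.
have tx_0 : Zp_dvd p 0 (t - 2%:R * x) by apply: Zp_dvdB.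
have yx : y - - x = p%:R by rewrite yE; ring.
have tx : t - 2%:R * x - - (2%:R * x) = t by ring.
have ty : t - 2%:R * y - 2%:R * x = t - 2%:R * p%:R by rewrite yE; ring.
apply: (Zp_dvdD p_pr); apply: Zp_congM.
- exact: Zp_dvdMl.
- exact: Zp_dvd0X.
- by apply: Zp_congM => //; rewrite ?tx //; apply: Zp_congX => //; rewrite yx.
- exact: Zp_congX.
- exact: Zp_dvdMl.
- exact: Zp_dvd0X.
- rewrite -mulrBr ty; apply: (Zp_dvdMl p_pr x3_0).
  by apply: Zp_dvdB => //; apply: Zp_dvdMl.
- exact: Zp_congX.
Qed.

Lemma cube_sum_cong n : (n < p)%N ->
  Zp_dvd p 4 (3%:R * (cube_sum p (t + n%:R)
    - ((-1) ^+ n * t + t ^+ 3 * (euler_poly (p - 3)).[- (t + n%:R)]))).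
Proof.
have p_gt2 : (2 < p)%N by apply: odd_prime_gt2.
have t3 : Zp_dvd p 3 (t ^+ 3) by apply: (Zp_dvdX p_pr 3 t_1).
have Nt_0 : Zp_dvd p 0 (- t) by apply: Zp_dvdN.
elim: n => [|n IHn] lt_np.
  rewrite addr0 expr0 mul1r.
  have -> : 3 * (cube_sum p t - (t + t ^+ 3 * (euler_poly (p - 3)).[- t]))
    = 3%:R * (cube_sum p t - t) - t ^+ 3 * (3%:R * ((euler_poly (p - 3)).[- t]
       - (euler_poly (p - 3)).[0])) - t ^+ 3 * (3%:R * (euler_poly (p - 3)).[0]).
    by ring.
  apply: Zp_dvdB => //; first apply: Zp_dvdB => //.
  - by apply: Zp_dvdMl => //; apply: cube_sum_near0.
  - apply: (Zp_dvdM p_pr t3); apply: Zp_dvdMl => //.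
    by apply: Zp_euler_poly_cong => //; rewrite ?Zp_dvd00 // subr0; apply: Zp_dvdN.
  (* Here t^3 gives only p^3. For p = 3 the factor 3 supplies the missing p; otherwise p - 3 is even
     and positive and the value at 0 vanishes. *)
  apply: (Zp_dvdM p_pr t3); have [p3 | p_n3] := eqVneq p 3%N.
    apply: Zp_dvdMr => //; first by rewrite -[X in Zp_dvd _ _ X%:R]p3 Zp_dvdp.
    by apply: Zp_euler_poly => //; apply: Zp_dvd00.
  rewrite euler_poly_eval0 ?mulr0 ?Zp_dvd00 //; first by lia.
  by rewrite oddB // p_odd.
set b := t + n%:R in IHn; set a := t + n.+1%:R.
have ab : a = b + 1 by rewrite /a /b -natr1; ring.
have a_0 : Zp_dvd p 0 a by rewrite /a Zp_dvdD.
have a_cong : Zp_dvd p 1 (a - n.+1%:R) by rewrite /a addrK.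
have a_u : ~~ Zp_dvd p 1 a.
  apply: contra (@Zp_unit_nat _ p_pr n.+1 lt_np) => a_1.
  have -> : n.+1%:R = a - t by rewrite /a; ring.
  exact: Zp_dvdB.
have a3_0 : Zp_dvd p 0 (a ^+ 3) by apply: Zp_dvd0X.
have a3_u : ~~ Zp_dvd p 1 (a ^+ 3) by apply: Zp_unitX.
have Vt := gbinom_p_cong lt_np; rewrite -/a in Vt.
have rec := cube_sum_rec p a; have [bE Na] : a - 1 = b /\ - b = - a + 1.
  by rewrite ab; split; ring.
rewrite bE in rec; have := euler_polyD1 (p - 3) (- a); rewrite -Na.
have sgn : (-1) ^+ (p - 3) = 1 :> rat by rewrite -signr_odd oddB // p_odd.
rewrite (exprNn a) sgn mul1r; have {IHn} := IHn (ltnW lt_np).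
set Ea := (euler_poly _).[- a]; set Eb := (euler_poly _).[- b].
move: rec Vt; set V := p%:R * _; set Fa := cube_sum p a; set Fb := cube_sum p b.
rewrite [(-1) ^+ n.+1]exprS mulN1r; set s := (-1) ^+ n => rec Vt Db EE.
(* The errors at a and at b = a - 1 are added: it suffices that their sum vanishes modulo p^4. *)
apply: (Zp_cong0 _ (Zp_dvdN p_pr Db)); rewrite opprK.
rewrite -mulrDr; apply: Zp_dvdMl => //; apply: (Zp_dvd_cancel p_pr a3_0 a3_u).
have ap : a ^+ p = a ^+ 3 * a ^+ (p - 3) by rewrite -exprD subnKC.
(* The signs cancel, and a^3 turns the Euler relation 2 a^(p-3) into 2 a^p. The three remainders
   vanish by [Zp_cong_cube], by the explicit p, and by Fermat. *)
have -> : a ^+ 3 * (Fa - (- s * t + t ^+ 3 * Ea) + (Fb - (s * t + t ^+ 3 * Eb)))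
   = (V ^+ 3 - t ^+ 3) * (2%:R * a - p%:R) - t ^+ 3 * p%:R
     - t ^+ 3 * (2%:R * (a ^+ p - a)).
  transitivity (a ^+ 3 * (Fa + Fb) - t ^+ 3 * (a ^+ 3 * (Ea + Eb))); first by ring.
  by rewrite rec EE ap; ring.
have p_1 := Zp_dvdp p_pr.
apply: Zp_dvdB => //; first apply: Zp_dvdB => //.
- apply: Zp_dvdMr => //; first exact: Zp_cong_cube.
  by apply: Zp_dvdB => //; apply: Zp_dvdMl.
- exact: (Zp_dvdM p_pr t3).
apply: (@Zp_dvdM _ p_pr 3 1) => //; apply: (Zp_dvdMl p_pr (Nz 2)).
exact: (Zp_fermat p_pr a_0 a_cong).
Qed.

End NearZero.

(** The search in [residue] is shown to succeed by exhibiting an integer congruent to a. *)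
Lemma residue_cong a : a \in Zp_loc p ->
  (residue p a < p)%N /\ Zp_dvd p 1 (a - (residue p a)%:R).
Proof.
move=> a_loc; have p_gt0 := prime_gt0 p_pr.
suff [r lt_rp ar] : exists2 r, (r < p)%N & Zp_dvd p 1 (a - r%:R).
  by rewrite (@residueP _ _ r) // -[p in eqmod_loc _ p]expn1 eqmod_loc_dvd.
have /Zp_locP[u [d p'd adE]] := a_loc.
have a_0 : Zp_dvd p 0 a by rewrite Zp_dvd0E.
have d_u : ~~ Zp_dvd p 1 d%:R by rewrite Zp_dvd1_nat.
(* By Fermat, [d ^ (p - 2)] is an inverse of [d] modulo [p]. *)
pose z := u * d%:Z ^+ (p - 2).
have az : Zp_dvd p 1 (a - z%:~R).
  (* Two factors d turn d^(p-2) into d^p, and a into u d. *)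
  apply: (Zp_dvd_cancel p_pr (Nz d) d_u); apply: (Zp_dvd_cancel p_pr (Nz d) d_u).
  have -> : d%:R * (d%:R * (a - z%:~R)) = - (u%:~R * (d%:R ^+ p - d%:R)).
    rewrite /z intrM rmorphXn /= -adE -[d%:Z%:~R]/(d%:R : rat).
    by rewrite -{2}(subnKC (prime_gt1 p_pr)) exprD; ring.
  apply: Zp_dvdN => //; apply: Zp_dvdMl (Zp_dvd_int p_pr u) _ => //.
  by apply: (@Zp_fermat _ p_pr _ d) => //; rewrite subrr Zp_dvd00.
clearbody z; have pz : p%:Z != 0 by rewrite eqz_nat -lt0n.
exists `|(z %% p)%Z|%N.
  by rewrite -ltz_nat gez0_abs ?modz_ge0 // ltz_pmod // ltz_nat.
apply: (Zp_cong0 (y := a - z%:~R)) => //.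
rewrite -[(`|_|%N)%:R]/(`|(z %% p)%Z|%N%:Z%:~R) gez0_abs ?modz_ge0 //.
have -> : z%:~R = (z %/ p)%Z%:~R * p%:R + (z %% p)%Z%:~R :> rat.
  by rewrite [in LHS](divz_eq z p) rmorphD rmorphM.
set q := (z %/ p)%Z; set r := (z %% p)%Z.
have -> : a - r%:~R - (a - (q%:~R * p%:R + r%:~R)) = q%:~R * p%:R by ring.
by apply: Zp_dvdMl; rewrite ?Zp_dvd_int ?Zp_dvdp.
Qed.

End Congruences.

(* The restriction p <> 3 on the first congruence is necessary: see
   first_congruence_fails_at_3. *)
Theorem theorem4p1 (p : nat) (a : rat) (p_pr : prime p) (p_odd : odd p)
    (a_Zp : a \in Zp_loc p) (a_n0 : ~~ eqmod_loc p p a 0) :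
  (p <> 3%N ->
   eqmod_loc p (p ^ 4)
     (\sum_(k < p) (1 - 2%:R / a * k%:R) * gbinom a k ^+ 3)
     ((-1) ^+ residue p a * ((a - (residue p a)%:R) / a)
      + (a - (residue p a)%:R) ^+ 3 / a * (euler_poly (p - 3)).[- a]))
  /\
  eqmod_loc p (p ^ 4)
    (\sum_(k < p) (1 - 2%:R / a * k%:R) ^+ 3 * gbinom a k ^+ 3)
    (- 3%:R * (-1) ^+ residue p a * ((a - (residue p a)%:R) / a)
     + ((a - (residue p a)%:R) / a) ^+ 3
       * (4%:R - 3%:R * a ^+ 2 * (euler_poly (p - 3)).[- a])).
Proof.
have [lt_np t_1] := residue_cong p_pr a_Zp.
have a_0 : Zp_dvd p 0 a by rewrite Zp_dvd0E.
have a_u : ~~ Zp_dvd p 1 a.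
  by move: a_n0; rewrite -{2}[p]expn1 eqmod_loc_dvd subr0.
have a0 : a != 0 by apply: contraNneq a_u => ->; apply: Zp_dvd00.
have := cube_sum_cong p_pr p_odd t_1 lt_np.
have := gbinom_p_cong p_pr p_odd t_1 lt_np.
move: t_1; rewrite subrK !eqmod_loc_dvd.
set n := residue p a; set t := a - n%:R; set E := _.[_] => t_1 Vt Da.
clearbody t E; split=> [p_n3|].
  have lt3p : (3 < p)%N by rewrite ltn_neqAle eq_sym odd_prime_gt2 ?andbT //; apply/eqP.
  (* For p > 3 the factor 3 of [cube_sum_cong] is a unit and cancels. *)
  have z3 := Zp_dvd_nat p_pr 3; have u3 := @Zp_unit_nat _ p_pr 3 lt3p.
  apply: (Zp_dvd_cancel p_pr a_0 a_u); have := Zp_dvd_cancel p_pr z3 u3 Da.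
  congr Zp_dvd; rewrite [RHS]mulrBr mulr_sumr.
  congr (_ - _); last by move: ((-1) ^+ n) => s; field.
  by apply: eq_bigr => k _; field.
apply: (@Zp_dvd_cancel _ p_pr 4 (a ^+ 3)); rewrite ?Zp_dvd0X ?Zp_unitX //.
(* The coefficient 3 a^2 from [sum_cube_gbinom_cube] provides the factor 3 of [cube_sum_cong], so p
   = 3 needs no exception here. *)
have -> : a ^+ 3 * (\sum_(k < p) (1 - 2 / a * k%:R) ^+ 3 * gbinom a k ^+ 3
    - (- 3 * (-1) ^+ n * (t / a) + (t / a) ^+ 3 * (4 - 3 * a ^+ 2 * E)))
  = 4%:R * ((p%:R * gbinom a p) ^+ 3 - t ^+ 3)
    - a ^+ 2 * (3%:R * (cube_sum p a - ((-1) ^+ n * t + t ^+ 3 * E))).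
  rewrite [4%:R * _]mulrBr -sum_cube_gbinom_cube mulrBr mulr_sumr.
  have -> : \sum_(k < p) a ^+ 3 * ((1 - 2 / a * k%:R) ^+ 3 * gbinom a k ^+ 3)
     = \sum_(k < p) (a - 2%:R * k%:R) ^+ 3 * gbinom a k ^+ 3.
    by apply: eq_bigr => k _; field.
  by move: (\sum_(_ < _) _) (cube_sum p a) ((-1) ^+ n) => S F s; field.
apply: Zp_dvdB => //; apply: Zp_dvdMl; rewrite ?Zp_dvd0X ?Zp_dvd_nat //.
exact: Zp_cong_cube.
Qed.
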